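(* For every $\hat V\subseteq V(\Pi)$ and every $\tau\in\mathbb{R}$, $$\operatorname{proj}_x\big(L^{EF}(\tau)\big)\subseteq \operatorname{proj}_x\big(L^{BM}_{\hat V}(\tau)\big).$$
   Context: Setting. Let $X\subseteq\mathbb{R}^{n_1}$, $g:X\to\mathbb{R}$, $q\in\mathbb{R}^{n_2}$, $W\in\mathbb{R}^{n_3\times n_2}$, $T\in\mathbb{R}^{n_3\times n_1}$, $h\in\mathbb{R}^{n_3}$. For $x\in X$ put $Y(x)=\{y\in\mathbb{R}^{n_2}_+ : Wy+Tx=h\}$, and $\Gamma=\{(x,y)\in\mathbb{R}^{n_1}\times\mathbb{R}^{n_2}_+ : x\in X,\ Wy+Tx=h\}$. The extensive form problem is $\min\{g(x)+q^Ty : (x,y)\in\Gamma\}$. Let $\Pi=\{\pi\in\mathbb{R}^{n_3} : \pi^TW\le q^T\}$ (componentwise) and let $V(\Pi)$ be its set of vertices. Standing assumptions: (relatively complete recourse) for every $x\in X$ there is $y\in Y(x)$ with $q^Ty<\infty$; (dual non-emptiness) $\Pi\ne\varnothing$; (existence of a minimizer) there is an optimal $(x^*,y^* )\in\Gamma$ for the extensive form problem; (finite solution) $z^*=g(x^* )+q^Ty^*>-\infty$. For $\hat V\subseteq V(\Pi)$ let $\operatorname{epi}(\hat Q_{\hat V})=\{(x,\theta)\in X\times\mathbb{R} : \theta\ge\pi^T(h-Tx)\ \ \forall\pi\in\hat V\}$. Sublevel sets: $L^{EF}(\tau)=\{(x,y)\in\Gamma : g(x)+q^Ty\le\tau\}$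 (extensive form), and $L^{BM}_{\hat V}(\tau)=\{(x,\theta)\in\operatorname{epi}(\hat Q_{\hat V}) : g(x)+\theta\le\tau\}$ (Benders master problem for the cut set $\hat V$). The operator $\operatorname{proj}_x$ is the projection onto the first $n_1$ coordinates (the $x$ variables), applied to sets elementwise. *)

(* Defs.v *)
From HB Require Import structures.
From mathcomp Require Import all_boot all_order all_algebra.
From mathcomp Require Import all_classical all_reals.

Set Implicit Arguments.
Unset Strict Implicit.
Unset Printing Implicit Defensive.

Import Order.TTheory GRing.Theory Num.Theory.
Local Open Scope classical_set_scope.
Local Open Scope ring_scope.

Definition dotc (R : realType) (n : nat) (u v : 'cV[R]_n) : R :=
  (u^T *m v) 0 0.

(* Vertices as extreme points: points of [P] that do not lie strictly between
   two distinct points of [P]. *)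
Definition vertices (R : realType) (n : nat) (P : set 'cV[R]_n) :
    set 'cV[R]_n :=
  [set p : 'cV[R]_n | P p /\
    forall (a b : 'cV[R]_n) (t : R), P a -> P b -> 0 < t -> t < 1 ->
      p = t *: a + (1 - t) *: b -> a = b].

Definition recourse_set (R : realType) (n1 n2 n3 : nat)
    (W : 'M[R]_(n3, n2)) (T : 'M[R]_(n3, n1)) (h : 'cV[R]_n3)
    (x : 'cV[R]_n1) : set 'cV[R]_n2 :=
  [set y : 'cV[R]_n2 | (forall j, 0 <= y j 0) /\ W *m y + T *m x = h].

Definition ef_feasible (R : realType) (n1 n2 n3 : nat) (X : set 'cV[R]_n1)
    (W : 'M[R]_(n3, n2)) (T : 'M[R]_(n3, n1)) (h : 'cV[R]_n3) :
    set ('cV[R]_n1 * 'cV[R]_n2) :=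
  [set z | X z.1 /\ recourse_set W T h z.1 z.2].

(* [g] is total for convenience: it is only evaluated where [z.1] lies in [X],
   so it stands for an arbitrary function on [X]. *)
Definition ef_objective (R : realType) (n1 n2 : nat) (g : 'cV[R]_n1 -> R)
    (q : 'cV[R]_n2) (z : 'cV[R]_n1 * 'cV[R]_n2) : R :=
  g z.1 + dotc q z.2.

Definition is_minimizer (R : realType) (U : Type) (S : set U) (f : U -> R)
    (z : U) : Prop :=
  S z /\ forall z', S z' -> f z <= f z'.

Definition dual_polyhedron (R : realType) (n2 n3 : nat)
    (q : 'cV[R]_n2) (W : 'M[R]_(n3, n2)) : set 'cV[R]_n3 :=
  [set p : 'cV[R]_n3 | forall j, (p^T *m W) 0 j <= q^T 0 j].

Definition cut_epi (R : realType) (n1 n3 : nat) (X : set 'cV[R]_n1)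
    (T : 'M[R]_(n3, n1)) (h : 'cV[R]_n3) (Vhat : set 'cV[R]_n3) :
    set ('cV[R]_n1 * R) :=
  [set w | X w.1 /\ forall p, Vhat p -> dotc p (h - T *m w.1) <= w.2].

Definition ef_sublevel (R : realType) (n1 n2 n3 : nat) (X : set 'cV[R]_n1)
    (g : 'cV[R]_n1 -> R) (q : 'cV[R]_n2) (W : 'M[R]_(n3, n2))
    (T : 'M[R]_(n3, n1)) (h : 'cV[R]_n3) (tau : R) :
    set ('cV[R]_n1 * 'cV[R]_n2) :=
  [set z | ef_feasible X W T h z /\ ef_objective g q z <= tau].

Definition bm_sublevel (R : realType) (n1 n3 : nat) (X : set 'cV[R]_n1)
    (g : 'cV[R]_n1 -> R) (T : 'M[R]_(n3, n1)) (h : 'cV[R]_n3)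
    (Vhat : set 'cV[R]_n3) (tau : R) : set ('cV[R]_n1 * R) :=
  [set w | cut_epi X T h Vhat w /\ g w.1 + w.2 <= tau].

Definition proj_x (U V : Type) (S : set (U * V)) : set U := fst @` S.

(* Main.v *)
Require Import Defs.
From HB Require Import structures.
From mathcomp Require Import all_boot all_order all_algebra.
From mathcomp Require Import all_classical all_reals.
Import Order.TTheory GRing.Theory Num.Theory.
Local Open Scope classical_set_scope.
Local Open Scope ring_scope.

(** A feasible [(x, y)] gives a master point over the same [x] by letting theta be its actual
    second-stage cost [dotc q y]. The objective value is unchanged, and by LP weak duality every
    dual feasible [p], in particular every vertex in [Vhat], gives a cut lying below that cost. *)

Lemma weak_duality (R : realType) (n1 n2 n3 : nat) (q : 'cV[R]_n2)
    (W : 'M[R]_(n3, n2)) (T : 'M[R]_(n3, n1)) (h : 'cV[R]_n3)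
    (x : 'cV[R]_n1) (y : 'cV[R]_n2) (p : 'cV[R]_n3) :
  recourse_set W T h x y -> dual_polyhedron q W p ->
  dotc p (h - T *m x) <= dotc q y.
Proof.
(* Eliminating [h] through the constraint turns [h - T *m x] into [W *m y]; regrouping as
   [(p^T *m W) *m y] lets dual feasibility be applied coordinatewise, weighted by [y >= 0]. *)
move=> [y_ge0 <-] pW; rewrite addrK /dotc mulmxA.
rewrite [leLHS]mxE [leRHS]mxE.
by apply: ler_sum => j _; rewrite ler_wpM2r.
Qed.

Theorem theorem1 (R : realType) (n1 n2 n3 : nat)
  (X : set 'cV[R]_n1) (g : 'cV[R]_n1 -> R) (q : 'cV[R]_n2)
  (W : 'M[R]_(n3, n2)) (T : 'M[R]_(n3, n1)) (h : 'cV[R]_n3)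
  (complete_recourse : forall x, X x ->
    exists2 y, recourse_set W T h x y & ((dotc q y)%:E < +oo)%E)
  (dual_nonempty : dual_polyhedron q W !=set0)
  (xs : 'cV[R]_n1) (ys : 'cV[R]_n2)
  (minimizer : is_minimizer (ef_feasible X W T h) (ef_objective g q) (xs, ys))
  (finite_solution : (-oo < (g xs + dotc q ys)%:E)%E)
  (Vhat : set 'cV[R]_n3) (tau : R) :
  Vhat `<=` vertices (dual_polyhedron q W) ->
  proj_x (ef_sublevel X g q W T h tau) `<=`
  proj_x (bm_sublevel X g T h Vhat tau).
Proof.
move=> sV _ [[x y] [[/= Xx Yxy] obj] <-].
(* With this theta the bound by [tau] is literally [obj], so what remains is the validity of the
   cuts at [x]. *)
exists (x, dotc q y) => //; split=> //; split=> // p /sV [Pp _].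
exact: weak_duality Yxy Pp.
Qed.
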